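(* For every positive integer $p$, there exists a $7p$-colourable $P_5$-free graph $G$ that is not $8p$-mixing, i.e., the reconfiguration graph $\mathcal{R}_{8p}(G)$ is disconnected.
   Context: All graphs are finite and simple. For a positive integer $k$, a $k$-colouring of a graph $G$ is a map $\alpha\colon V(G)\to\{1,\dots,k\}$ with $\alpha(u)\neq\alpha(v)$ for every edge $uv$; $G$ is $k$-colourable if it has a $k$-colouring. The reconfiguration graph $\mathcal{R}_k(G)$ has as vertices the $k$-colourings of $G$, two colourings being adjacent if they differ in colour on exactly one vertex of $G$. $G$ is $k$-mixing if $\mathcal{R}_k(G)$ is connected. $P_5$ denotes the path on $5$ vertices, and $G$ is $P_5$-free if it has no induced subgraph isomorphic to $P_5$. *)

(* Defs.v *)
From mathcomp Require Import all_boot.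

Set Implicit Arguments.
Unset Strict Implicit.
Unset Printing Implicit Defensive.

Record sgraph := SGraph {
  vertex :> finType;
  edge : rel vertex;
  edge_sym : symmetric edge;
  edge_irrefl : irreflexive edge }.

Definition connected (G : sgraph) : Prop := forall x y : G, connect (@edge G) x y.

Definition isomorphic (G H : sgraph) : Prop :=
  exists2 f : G -> H, bijective f & forall x y, edge (f x) (f y) = edge x y.

Section Induced.
Variables (G : sgraph) (S : {set G}).

Definition induced_edge : rel {x : G | x \in S} := fun x y => edge (val x) (val y).

Lemma induced_edge_sym : symmetric induced_edge.
Proof. by move=> x y; apply: edge_sym. Qed.

Lemma induced_edge_irrefl : irreflexive induced_edge.
Proof. by move=> x; apply: edge_irrefl. Qed.

Definition induced : sgraph := SGraph induced_edge_sym induced_edge_irrefl.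
End Induced.

Definition free (H G : sgraph) : Prop :=
  forall S : {set G}, ~ isomorphic (induced S) H.

Section PathGraph.
Variable n : nat.

Definition path_edge : rel 'I_n := fun i j => (i.+1 == j) || (j.+1 == i).

Lemma path_edge_sym : symmetric path_edge.
Proof. by move=> i j; rewrite /path_edge orbC. Qed.

Lemma path_edge_irrefl : irreflexive path_edge.
Proof. by move=> i; rewrite /path_edge orbb -[X in _ == X]addn0 -addn1 eqn_add2l. Qed.

(* The path on n vertices (not n edges). *)
Definition path_graph : sgraph := SGraph path_edge_sym path_edge_irrefl.
End PathGraph.

Section Colouring.
Variables (k : nat) (G : sgraph).

Definition proper_colouring (c : {ffun G -> 'I_k}) : bool :=
  [forall u, forall v, edge u v ==> (c u != c v)].

Definition colouring : finType := {c : {ffun G -> 'I_k} | proper_colouring c}.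

Definition colourable : Prop := exists c : {ffun G -> 'I_k}, proper_colouring c.

Definition reconf_edge : rel colouring :=
  fun a b => #|[set v | val a v != val b v]| == 1.

Lemma reconf_edge_sym : symmetric reconf_edge.
Proof.
move=> a b; rewrite /reconf_edge; congr (_ == 1).
by apply: eq_card => v; rewrite !inE eq_sym.
Qed.

Lemma reconf_edge_irrefl : irreflexive reconf_edge.
Proof.
move=> a; rewrite /reconf_edge (_ : [set _ | _] = set0) ?cards0 //.
by apply/setP => v; rewrite !inE eqxx.
Qed.

Definition reconf_graph : sgraph := SGraph reconf_edge_sym reconf_edge_irrefl.

Definition mixing : Prop := connected reconf_graph.
End Colouring.

(* Main.v *)
Require Import Defs.
From mathcomp Require Import all_boot zify.

(** Given two colourings [f] and [g] of the same vertex set, join two vertices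
    exactly when both colourings separate them; both are then proper.  The
    complement is the union of two disjoint unions of cliques, one for each
    colouring.  We choose eight [f]-classes of size two and seven [g]-classes
    (two triangles and five edges) so that this union consists of two triangles
    joined by three disjoint paths of lengths 3, 5 and 5.  It has no induced
    [C4], so the graph is [2K2]-free, hence [P5]-free.  No two [f]-mates have
    the same [g]-colour, so every vertex is adjacent to one of the two vertices
    of each other [f]-class: the 8-colouring [f] is frozen.  The join of [p]
    copies of this graph proves the theorem. *)

Set Implicit Arguments.
Unset Strict Implicit.
Unset Printing Implicit Defensive.

Section Frozen.
Variables (k : nat) (G : sgraph).

Definition frozen (c : {ffun G -> 'I_k}) : Prop :=
  forall (v : G) (j : 'I_k), j != c v -> exists2 u, edge v u & c u = j.

(** Moving a single vertex [v] to a new colour [j] clashes with a neighbour of [v] that already has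
    colour [j]. *)
Lemma frozen_isolated (a b : colouring k G) :
  frozen (val a) -> ~~ reconf_edge a b.
Proof.
move=> fr; apply/negP => /cards1P [v /setP eq_v].
have same u : u != v -> val b u = val a u.
  by move=> uv; have:= eq_v u; rewrite !inE (negPf uv) => /negbFE/eqP.
have neq_v : val b v != val a v by have:= eq_v v; rewrite !inE eqxx eq_sym.
have [u vu cu] := fr _ _ neq_v.
have uv : u != v by apply: contraTneq vu => ->; rewrite edge_irrefl.
by have /forallP/(_ v)/forallP/(_ u) := valP b; rewrite vu (same u uv) cu eqxx.
Qed.

Lemma frozen_not_mixing (a b : colouring k G) :
  frozen (val a) -> a != b -> ~ mixing k G.
Proof.
move=> fr /eqP ab /(_ a b)/connectP[[|c s] /=]; first by move=> _ /esym.
by case/andP => /= ac; have:= frozen_isolated c fr; rewrite ac.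
Qed.

End Frozen.

Definition two_K2_free (G : sgraph) : Prop :=
  forall x y z t : G, edge x y -> edge z t ->
    [|| edge x z, edge x t, edge y z | edge y t].

Lemma two_K2_free_P5_free (G : sgraph) :
  two_K2_free G -> free (path_graph 5) G.
Proof.
move=> h S [f [g _ gK] fE].
have gE i j : edge (val (g i)) (val (g j)) = path_edge i j.
  by rewrite -[RHS]/(edge (i : path_graph 5) j) -{2}(gK i) -{2}(gK j) fE.
(* The two end edges of the path, 01 and 34, induce a [2K2]. *)
have := h (val (g (inord 0))) (val (g (inord 1)))
          (val (g (inord 3))) (val (g (inord 4))).
by rewrite !gE /path_edge !inordK // => /(_ isT isT).
Qed.

Section BicolouredGraph.
Variables (T : finType) (f g : T -> nat).

Definition bicol_edge : rel T := fun x y => (f x != f y) && (g x != g y).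

Lemma bicol_edge_sym : symmetric bicol_edge.
Proof. by move=> x y; rewrite /bicol_edge (eq_sym (f x)) (eq_sym (g x)). Qed.

Lemma bicol_edge_irrefl : irreflexive bicol_edge.
Proof. by move=> x; rewrite /bicol_edge eqxx. Qed.

Definition bicol_graph : sgraph := SGraph bicol_edge_sym bicol_edge_irrefl.

Lemma bicol_proper_l k (c : {ffun bicol_graph -> 'I_k}) :
  (forall x, c x = f x :> nat) -> proper_colouring c.
Proof.
move=> cf; apply/forallP => x; apply/forallP => y; apply/implyP => /andP[xy _].
by rewrite -val_eqE /= !cf.
Qed.

Lemma bicol_proper_r k (c : {ffun bicol_graph -> 'I_k}) :
  (forall x, c x = g x :> nat) -> proper_colouring c.
Proof.
move=> cg; apply/forallP => x; apply/forallP => y; apply/implyP => /andP[_ xy].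
by rewrite -val_eqE /= !cg.
Qed.

Lemma bicol_frozen k (c : {ffun bicol_graph -> 'I_k}) :
  (forall x, c x = f x :> nat) ->
  (forall j, j < k -> exists x y, [/\ f x = j, f y = j & g x <> g y]) ->
  frozen c.
Proof.
move=> cf two v j jv.
have [x [y [fx fy gxy]]] := two j (ltn_ord j).
have fv : f v != j by rewrite -cf eq_sym.
(* At most one of [x], [y] shares the [g]-colour of [v]; the other is the neighbour sought. *)
case: (g v =P g x) => [gvx|/eqP gvx].
  exists y; last by apply: val_inj; rewrite /= cf.
  by rewrite /= /bicol_edge fy fv gvx; apply/eqP.
exists x; last by apply: val_inj; rewrite /= cf.
by rewrite /= /bicol_edge fx fv.
Qed.

End BicolouredGraph.

(* The triangles are [0; 2; 4] and [7; 11; 15]; the paths, which alternate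
   between [f]-mates [2j, 2j+1] and [g]-classes of size two, are
   [0 1 6 7], [2 3 8 9 10 11] and [4 5 12 13 14 15]. *)
Definition base_col (v : nat) : nat :=
  nth 0 [:: 0; 2; 0; 3; 0; 5; 2; 1; 3; 4; 4; 1; 5; 6; 6; 1] v.

Definition base_edge (u v : nat) : bool :=
  (u./2 != v./2) && (base_col u != base_col v).

Lemma base_col_lt v : base_col v < 7.
(* Past index 15 the default value 0 keeps the bound. *)
Proof. by do 16?[case: v => [//|v]]; rewrite /base_col nth_default. Qed.

Lemma base_col_mates j : j < 8 -> base_col j.*2 <> base_col j.*2.+1.
Proof. by do 8?[case: j => [//|j]]. Qed.

Lemma base_two_K2_free x y z t :
  x < 16 -> y < 16 -> z < 16 -> t < 16 -> base_edge x y -> base_edge z t ->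
  [|| base_edge x z, base_edge x t, base_edge y z | base_edge y t].
Proof.
(* Testing [z] against [x] and [y] before ranging over [t] prunes the enumeration of quadruples. *)
have /allP chk : all (fun x => all (fun y => base_edge x y ==>
  all (fun z => base_edge x z || base_edge y z || all (fun t => base_edge z t ==>
    (base_edge x t || base_edge y t)) (iota 0 16)) (iota 0 16))
    (iota 0 16)) (iota 0 16) by vm_compute.
move=> x16 y16 z16 t16 xy zt.
have mem n : n < 16 -> n \in iota 0 16 by rewrite mem_iota.
have /allP/(_ y (mem _ y16)) := chk x (mem _ x16).
move=> /implyP/(_ xy)/allP/(_ z (mem _ z16))/orP[/orP[-> //|->]|].
  by rewrite !orbT.
by move=> /allP/(_ t (mem _ t16))/implyP/(_ zt)/orP[] ->; rewrite !orbT.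
Qed.

Section Join.
Variable p : nat.

Definition join_f (x : 'I_p * 'I_16) : nat := 8 * x.1 + x.2./2.
Definition join_g (x : 'I_p * 'I_16) : nat := 7 * x.1 + base_col x.2.

Definition join_graph : sgraph := bicol_graph join_f join_g.

Lemma join_f_lt x : join_f x < 8 * p.
Proof.
by case: x => i v; rewrite /join_f /=; have:= ltn_ord i; have:= ltn_ord v; lia.
Qed.

Lemma join_g_lt x : join_g x < 7 * p.
Proof.
by case: x => i v; rewrite /join_g /=; have:= ltn_ord i; have:= base_col_lt v; lia.
Qed.

(** Distinct copies use disjoint blocks of 8 [f]-colours and of 7 [g]-colours, so both colourings
    separate their vertices. *)
Lemma join_nonedge_copy (x y : join_graph) : ~~ edge x y -> x.1 = y.1.
Proof.
case: x y => [i u] [j v]; rewrite /= /bicol_edge /join_f /join_g /= => h.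
apply: val_inj => /=; move: h.
have := ltn_ord u; have := ltn_ord v; have := base_col_lt u; have := base_col_lt v.
lia.
Qed.

Lemma join_edge_copy (x y : join_graph) :
  x.1 = y.1 -> edge x y = base_edge x.2 y.2.
Proof.
by move=> xy; rewrite /= /bicol_edge /join_f /join_g xy !eqn_add2l.
Qed.

Lemma join_two_K2_free : two_K2_free join_graph.
Proof.
move=> x y z t xy zt; apply/negPn/negP; rewrite !negb_or => /and4P[xz xt yz yt].
(* The four non-edges put all four vertices in one copy, where the finite check applies. *)
have [exz ext eyz eyt] :
    [/\ x.1 = z.1, x.1 = t.1, y.1 = z.1 & y.1 = t.1].
  by split; apply: join_nonedge_copy.
have := base_two_K2_free (ltn_ord x.2) (ltn_ord y.2) (ltn_ord z.2) (ltn_ord t.2).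
rewrite -!join_edge_copy ?exz -?ext //; last by rewrite eyz.
by rewrite xy zt (negPf xz) (negPf xt) (negPf yz) (negPf yt) => /(_ isT isT).
Qed.

Lemma join_f_mates j :
  j < 8 * p -> exists x y, [/\ join_f x = j, join_f y = j & join_g x <> join_g y].
Proof.
move=> jp.
have ip : j %/ 8 < p by lia.
have r8 : j %% 8 < 8 by lia.
have v0 : (j %% 8).*2 < 16 by lia.
have v1 : (j %% 8).*2.+1 < 16 by lia.
exists (Ordinal ip, Ordinal v0), (Ordinal ip, Ordinal v1).
rewrite /join_f /join_g /=; split; try lia.
by have := base_col_mates r8; lia.
Qed.

End Join.

Theorem theorem1 (p : nat) (hp : 0 < p) :
  exists G : sgraph,
    [/\ colourable (7 * p) G, free (path_graph 5) G & ~ mixing (8 * p) G].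
Proof.
exists (join_graph p); split.
- exists [ffun x => Ordinal (join_g_lt x)].
  by apply: bicol_proper_r => x; rewrite ffunE.
- exact/two_K2_free_P5_free/join_two_K2_free.
- have le78 : 7 * p <= 8 * p by rewrite leq_mul2r orbT.
  pose a : {ffun join_graph p -> 'I_(8 * p)} := [ffun x => Ordinal (join_f_lt x)].
  pose b : {ffun join_graph p -> 'I_(8 * p)} :=
    [ffun x => widen_ord le78 (Ordinal (join_g_lt x))].
  have af x : a x = join_f x :> nat by rewrite ffunE.
  have bg x : b x = join_g x :> nat by rewrite ffunE.
  pose a' : colouring (8 * p) (join_graph p) := Sub a (bicol_proper_l af).
  pose b' : colouring (8 * p) (join_graph p) := Sub b (bicol_proper_r bg).
  apply: (@frozen_not_mixing _ _ a' b').
    by apply: (bicol_frozen af); apply: join_f_mates.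
  (* Vertex 2 of copy 0 has [f]-colour 1 and [g]-colour 0. *)
  apply/eqP => /(congr1 val)/= /ffunP/(_ (Ordinal hp, inord 2))/(congr1 val) /=.
  by rewrite af bg /join_f /join_g /= inordK.
Qed.
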